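(* Let $r\in\mathbb R_{\ge2}$ be irrational and let $f:C\to C$ be a cohomomorphism from $E_r^{\mathrm o}$ to itself, or a cohomomorphism from $E_r^{\mathrm c}$ to itself. Then $f$ is a rotation of the circle $C$, possibly composed with a reflection.
   Context: A cohomomorphism $G\to H$ between (possibly infinite) simple graphs is a map $f:V(G)\to V(H)$ such that for all distinct non-adjacent $u,v\in V(G)$ the vertices $f(u),f(v)$ are distinct and non-adjacent in $H$. Let $C$ be a circle of unit circumference, with distance measured along the circle. For $r\in\mathbb R_{\ge2}$, $E_r^{\mathrm o}$ (resp. $E_r^{\mathrm c}$) is the graph with vertex set $C$ in which two distinct vertices are adjacent iff their distance on $C$ is strictly less than $1/r$ (resp. at most $1/r$). *)

(* Defs.v *)
From HB Require Import structures.
From mathcomp Require Import all_boot all_order all_algebra.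
From mathcomp Require Import classical_sets reals.

Set Implicit Arguments.
Unset Strict Implicit.
Unset Printing Implicit Defensive.

Import Order.TTheory GRing.Theory Num.Theory.

Local Open Scope ring_scope.
Local Open Scope quotient_scope.

Record simple_graph := SimpleGraph {
  vertex :> Type;
  adj : vertex -> vertex -> Prop;
  adj_sym : forall u v, adj u v -> adj v u;
  adj_irrefl : forall u, ~ adj u u
}.

Definition cohomomorphism (G H : simple_graph) (f : G -> H) : Prop :=
  forall u v : G, u <> v -> ~ adj u v -> f u <> f v /\ ~ adj (f u) (f v).

(* The circle of unit circumference as the additive group R/Z: a real number
   is read as a signed arc length from a base point. *)
Definition circle (R : realType) : Type :=
  Quotient.quot (GRing.ZmodClosed.clone R (@Num.int_num_subdef R) _).

HB.instance Definition _ (R : realType) := ZmodQuotient.on (circle R).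

(* Length in [0, 1[ of the arc running in the positive direction from p to q:
   the fractional part of any representative of q - p (see arcE). *)
Definition arc (R : realType) (p q : circle R) : R :=
  repr (q - p) - (Num.floor (repr (q - p)))%:~R.

Lemma arcE (R : realType) (x y : R) :
  arc (\pi_(circle R) x) (\pi_(circle R) y) = (y - x) - (Num.floor (y - x))%:~R.
Proof.
rewrite /arc -raddfB.
set t := repr _; have : t - (y - x) \in @Num.int_num_subdef R.
  have -> := Quotient.idealrBE
    (GRing.ZmodClosed.clone R (@Num.int_num_subdef R) _).
  exact/eqP/reprK.
move: (y - x) => z tz.
rewrite -[t](subrK z) floorDzr// intrD.
have /eqP -> : (Num.floor (t - z))%:~R == t - z by rewrite -intrEfloor.
by rewrite opprD addrACA subrr add0r.
Qed.

(* Distance along the circle: the length of the shorter of the two arcs. *)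
Definition circle_dist (R : realType) (p q : circle R) : R :=
  Num.min (arc p q) (arc q p).

Lemma circle_distC (R : realType) (p q : circle R) :
  circle_dist p q = circle_dist q p.
Proof. exact: minC. Qed.

Definition open_adj (R : realType) (r : R) (p q : circle R) : Prop :=
  p <> q /\ circle_dist p q < r^-1.

Definition closed_adj (R : realType) (r : R) (p q : circle R) : Prop :=
  p <> q /\ circle_dist p q <= r^-1.

Lemma open_adj_sym (R : realType) (r : R) (p q : circle R) :
  open_adj r p q -> open_adj r q p.
Proof. by move=> [/nesym npq]; rewrite circle_distC. Qed.

Lemma closed_adj_sym (R : realType) (r : R) (p q : circle R) :
  closed_adj r p q -> closed_adj r q p.
Proof. by move=> [/nesym npq]; rewrite circle_distC. Qed.

Lemma open_adj_irrefl (R : realType) (r : R) (p : circle R) : ~ open_adj r p p.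
Proof. by case. Qed.

Lemma closed_adj_irrefl (R : realType) (r : R) (p : circle R) :
  ~ closed_adj r p p.
Proof. by case. Qed.

Definition E_open (R : realType) (r : R) : simple_graph :=
  SimpleGraph (@open_adj_sym R r) (@open_adj_irrefl R r).

Definition E_closed (R : realType) (r : R) : simple_graph :=
  SimpleGraph (@closed_adj_sym R r) (@closed_adj_irrefl R r).

Definition rotation (R : realType) (a p : circle R) : circle R := p + a.

(* Reflection in the diameter through c. *)
Definition reflection (R : realType) (c p : circle R) : circle R := c *+ 2 - p.

(* Main.v *)
Require Import Defs.
From mathcomp Require Import all_boot all_order all_algebra.
From mathcomp Require Import classical_sets reals.
From mathcomp Require Import zify ring lra.

Set Implicit Arguments.
Unset Strict Implicit.
Unset Printing Implicit Defensive.

Import Order.TTheory GRing.Theory Num.Theory.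

Local Open Scope ring_scope.

(** Write d = 1/r, an irrational number in ]0, 1/2[, and lift f to a 1-periodic
map g of the real line.  All that is used of f is that points at distance more
than d have images at distance at least d; this holds for both graphs.

The images of a fine regular sample are equidistributed.  Take fractions q/p
slightly above d, with excess e = q - p d > 0 as small as needed, and sample the
circle at the p points i/p.  Sample points whose images fall into a common
half-open arc of length d are pairwise at distance less than q/p, and p >= 2q, so
there are at most q of them (circular_independent_card, arc_count_window_le).
Lay P consecutive arcs of length d along the circle, so that they wind Q times
around it and then cover a further arc of length P d - Q: this arc contains at
most P q - Q p = p (P d - Q) + P e images.  Since d is irrational, P d - Q can be
made close to any length L, so every arc of length L contains at most p (L + eta)
images once e is small (arc_count_le), and by passing to the complementary arc
also at least p (L - eta) of them (arc_count_ge).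

Equidistribution makes g locally 1-Lipschitz.  A sample point whose image is
within d of g x (resp. g y) is itself within d of x (resp. y).  If, for close x and
y, the images g x and g y were farther apart than x and y, the union of the two balls of radius d around the
images would be longer than the union of the balls around x and y, and would
receive more images than there are sample points to provide them
(far_preserving_local_lipschitz).  Subdividing, g is 1-Lipschitz at every scale.

Now two points at distance d have images at distance at most d, and at least d
by continuity: g (x + d) = g x + d or g x - d modulo 1.  The sign is locally
constant by continuity, hence constant.  If it is +, then
g (x + k d) = g x + k d modulo 1 for all k, and density of the multiples of d
gives g y - g x = y - x modulo 1; if it is -, the same applies to - g. *)

(** * Distances modulo 1 *)

Definition near_int (R : realType) (e t : R) : Prop :=
  exists n : int, `|t - n%:~R| <= e.

(** The contrapositive of the property of cohomomorphisms that the proof relies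
on, for a lift g of a self-map of the circle.  One inequality is strict and the
other is not, so that the open and the closed graph both satisfy it. *)
Definition far_preserving (R : realType) (d : R) (g : R -> R) : Prop :=
  forall (x y : R) (n : int), `|g x - g y - n%:~R| < d -> near_int d (x - y).

Lemma near_intN (R : realType) (e t : R) : near_int e t -> near_int e (- t).
Proof. by case=> n nP; exists (- n); rewrite rmorphN/= -opprD normrN. Qed.

Lemma near_intD (R : realType) (e e' t t' : R) :
  near_int e t -> near_int e' t' -> near_int (e + e') (t + t').
Proof.
move=> [n nP] [m mP]; exists (n + m); apply: le_trans (lerD nP mP).
by rewrite intrD opprD addrACA ler_normD.
Qed.

Lemma floorE (R : realType) (n : int) (a : R) :
  n%:~R <= a < n%:~R + 1 -> Num.floor a = n.
Proof. by move=> an; apply: floor_def; rewrite intrD. Qed.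

Lemma floorP (R : realType) (a : R) :
  exists n : int, n%:~R <= a < n%:~R + 1.
Proof. by exists (Num.floor a); have := floor_itv a; rewrite intrD. Qed.

(** * Indicators and counts of arcs *)

(** For 0 <= L <= 1 this is the indicator of the half-open arc [0, L[ of R/Z; for
larger L it counts how often [0, L[ covers the point.  Written with floors, it
is additive under concatenation of arcs whatever their lengths. *)
Definition arc_ind (R : realType) (L a : R) : R :=
  (Num.floor a)%:~R - (Num.floor (a - L))%:~R.

Lemma arc_indE (R : realType) (L a : R) (n : int) :
  0 <= L <= 1 -> n%:~R <= a < n%:~R + 1 -> arc_ind L a = (a - n%:~R < L)%R%:R.
Proof.
move=> L01 an; rewrite /arc_ind (floorE an); case: ltP => aL.
  rewrite (@floorE _ (n - 1)) ?intrB; first by rewrite /=; ring.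
  by apply/andP; split; lra.
by rewrite (@floorE _ n) ?subrr//; apply/andP; split; lra.
Qed.

Lemma arc_ind1P (R : realType) (L a : R) (n : int) :
  0 <= L <= 1 -> 0 <= a - n%:~R < L -> arc_ind L a = 1.
Proof.
move=> L01 anL; rewrite (@arc_indE _ _ _ n)//; last by apply/andP; split; lra.
by rewrite (_ : _ < _); [|lra].
Qed.

Lemma arc_indP (R : realType) (L a : R) : 0 <= L <= 1 ->
  arc_ind L a = 0 \/ arc_ind L a = 1 /\ exists n : int, 0 <= a - n%:~R < L.
Proof.
move=> L01; have [n an] := floorP a.
rewrite (arc_indE L01 an); case: ltP => aL; [right|by left].
by split=> //; exists n; apply/andP; split; lra.
Qed.

Lemma arc_indD (R : realType) (L L' a : R) :
  arc_ind (L + L') a = arc_ind L a + arc_ind L' (a - L).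
Proof. by rewrite /arc_ind opprD addrA addrA subrK. Qed.

Lemma arc_ind_int (R : realType) (n : int) (a : R) : arc_ind n%:~R a = n%:~R.
Proof.
have [m am] := floorP a.
rewrite /arc_ind (floorE am) (@floorE _ (m - n)) intrB; first by ring.
by apply/andP; split; lra.
Qed.

Lemma arc_ind_ge0 (R : realType) (L a : R) : 0 <= L -> 0 <= arc_ind L a.
Proof.
by move=> L0; rewrite /arc_ind subr_ge0 ler_int; apply: le_floor; lra.
Qed.

(** Number of indices i < p for which g (i/p) lies in the arc of length L that
starts at t, with multiplicity when L > 1. *)
Definition arc_count (R : realType) (g : R -> R) (p : nat) (L t : R) : R :=
  \sum_(i < p) arc_ind L (g (i%:R / p%:R) - t).

Lemma arc_countD (R : realType) (g : R -> R) (p : nat) (L L' t : R) :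
  arc_count g p (L + L') t = arc_count g p L t + arc_count g p L' (t + L).
Proof.
rewrite /arc_count -big_split /=; apply: eq_bigr => i _; rewrite arc_indD.
by congr (_ + arc_ind _ _); ring.
Qed.

Lemma arc_count_int (R : realType) (g : R -> R) (p : nat) (n : int) (t : R) :
  arc_count g p n%:~R t = n%:~R * p%:R :> R.
Proof.
rewrite /arc_count (eq_bigr (fun=> n%:~R)) => [|i _]; last by rewrite arc_ind_int.
by rewrite sumr_const card_ord mulr_natr.
Qed.

Lemma arc_count_mono (R : realType) (g : R -> R) (p : nat) (L L' t : R) :
  L <= L' -> arc_count g p L t <= arc_count g p L' t.
Proof.
move=> LL; rewrite -[L'](subrK L) addrC arc_countD lerDl.
by apply: sumr_ge0 => i _; apply: arc_ind_ge0; rewrite subr_ge0.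
Qed.

(** * Independent sets of the sample *)

(** Seen from a fixed i0 in S, the other members are at offsets 1, ..., q - 1 or
p - q + 1, ..., p - 1.  Offsets k and k + (p - q) are at circular distance q, so
at most one of them occurs; identifying them embeds S into 'I_q. *)
Lemma circular_independent_card (p q : nat) (S : {set 'I_p}) :
  (0 < q)%N -> (2 * q <= p)%N ->
  (forall i j : 'I_p, i \in S -> j \in S -> (i <= j)%N ->
    (j - i < q)%N || (p < j - i + q)%N) ->
  (#|S| <= q)%N.
Proof.
case: q => // q _ q2p Sq; have [->|[i0 i0S]] := set_0Vmem S; first by rewrite cards0.
pose res (i : 'I_p) : nat := if (i0 <= i)%N then (i - i0)%N else (i + p - i0)%N.
pose h (i : 'I_p) : 'I_q.+1 :=
  inord (if (res i < q.+1)%N then res i else (res i - (p - q.+1))%N).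
have resE (i : 'I_p) : i \in S -> (res i < q.+1)%N \/ (p - q.+1 < res i < p)%N.
  move=> iS; have ip := ltn_ord i; have i0p := ltn_ord i0.
  rewrite /res; case: (leqP i0 i) => ii0.
    have := Sq _ _ i0S iS ii0; lia.
  have := Sq _ _ iS i0S (ltnW ii0); lia.
suff hinj : {in S &, injective h}.
  by rewrite -(card_in_imset hinj) (leq_trans (max_card _))// card_ord.
move=> i j iS jS /(congr1 val).
rewrite /h /= !inordK; last 2 first.
- by have := resE _ jS; case: ifP; lia.
- by have := resE _ iS; case: ifP; lia.
move=> hij; apply/val_inj => /=; move: hij.
have := ltn_ord i; have := ltn_ord j; have := ltn_ord i0.
have := resE _ iS; have := resE _ jS.
have := Sq _ _ iS jS; have := Sq _ _ jS iS.
rewrite /res; case: (leqP i0 i) => ?; case: (leqP i0 j) => ?;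
  (case: (leqP i j) => [ij _ /(_ isT)|/ltnW ji /(_ ji) + _]);
  by do 2 case: ifP => ?; lia.
Qed.

(** * Rational approximation from above *)

Lemma nat_quotient (R : realType) (b c : R) : 0 < b -> 0 <= c ->
  exists j : nat, j%:R * b <= c < j%:R * b + b.
Proof.
move=> b0 c0; exists (Num.trunc (c / b)).
have /truncn_itv : 0 <= c / b by rewrite divr_ge0// ltW.
by rewrite ler_pdivlMr// ltr_pdivrMr// -natr1 mulrDl mul1r.
Qed.

Lemma irrational_mulrn_neq (R : realType) (d : R) (p : nat) (q : int) :
  irrational d -> (0 < p)%N -> p%:R * d != q%:~R.
Proof.
move=> irr p0; apply/negP => /eqP pdq; apply: irr.
have pn0 : p%:R != 0 :> R by rewrite pnatr_eq0; lia.
exists (q%:~R / p%:R); first by [].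
by rewrite fmorph_div/= ratr_int ratr_nat -pdq mulrC mulKf.
Qed.

(** Two steps of the Euclidean algorithm: with e = q - p d, reduce 1 modulo e to
get a, then e modulo a.  The first remainder is of the form p' d - q', the second
again of the form q' - p' d, and it is less than both a and e - a.
Irrationality keeps the remainders positive. *)
Lemma below_approx_step (R : realType) (d : R) (p : nat) (q : int) :
  irrational d -> (0 < p)%N -> 0 < q%:~R - p%:R * d < 1 ->
  exists (p' : nat) (q' : int), (0 < p')%N /\
    0 < q'%:~R - p'%:R * d /\ 2 * (q'%:~R - p'%:R * d) < q%:~R - p%:R * d.
Proof.
move=> irr p0; set e := _ - _ => /andP[e0 e1].
have [j /andP[je ej]] := @nat_quotient R e 1 e0 ler01.
have j0 : (0 < j)%N by case: j je ej => // _; lra.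
pose a := 1 - j%:R * e.
have aE : a = (j * p)%:R * d - (j%:Z * q - 1)%:~R.
  by rewrite /a /e natrM intrB intrM /=; ring.
have a0 : 0 < a.
  rewrite lt_neqAle eq_sym subr_ge0 je andbT aE subr_eq0.
  by apply: irrational_mulrn_neq => //; rewrite muln_gt0 j0.
have ae : a < e by rewrite /a; lra.
have [l /andP[le el]] := @nat_quotient R a e a0 (ltW e0).
have l0 : (0 < l)%N by case: l le el => // _; lra.
exists (p + l * (j * p))%N, (q + l%:Z * (j%:Z * q - 1)); split; first lia.
set e' := _ - _; have e'E : e' = e - l%:R * a.
  by rewrite /e' aE /e natrD (natrM _ l) intrD intrM /=; ring.
have e'n0 : e' != 0.
  by rewrite subr_eq0 eq_sym; apply: irrational_mulrn_neq => //; lia.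
have l1 : a <= l%:R * a by rewrite ler_peMl ?ler1n// ltW.
by split; [rewrite lt_neqAle eq_sym e'n0/= e'E; lra|rewrite e'E; lra].
Qed.

Lemma below_approx (R : realType) (d eta : R) :
  irrational d -> 0 < d < 1 -> 0 < eta ->
  exists p q : nat, (0 < p)%N /\ 0 < q%:R - p%:R * d < eta.
Proof.
move=> irr /andP[d0 d1] eta0.
have halving k : exists (p : nat) (q : int),
    (0 < p)%N /\ 0 < q%:~R - p%:R * d /\ 2 ^+ k * (q%:~R - p%:R * d) < 1.
  elim: k => [|k [p [q [p0 [e0 ke]]]]].
    by exists 1%N, 1; split=> //; rewrite expr0 /=; split; lra.
  have e1 : q%:~R - p%:R * d < 1.
    apply: le_lt_trans ke; rewrite ler_peMl ?(ltW e0)//.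
    by rewrite exprn_ege1// ler1n.
  have [|p' [q' [p'0 [e'0 e'e]]]] := @below_approx_step R d p q irr p0.
    by rewrite e0.
  exists p', q'; split=> //; split=> //.
  apply: le_lt_trans ke; rewrite exprSr -mulrA ler_pM2l ?exprn_gt0//.
  exact: ltW.
pose k := Num.bound eta^-1.
have kP : eta^-1 < 2 ^+ k by apply: upper_nthrootP.
have [p [q [p0 [e0 ke]]]] := halving k.
have pd0 : 0 < p%:R * d by rewrite mulr_gt0// ltr0n.
have q0 : 0 <= q by rewrite -(ler_int R) /=; lra.
case: q q0 e0 ke => // q _ e0 ke.
exists p, q; split=> //; rewrite e0 /=.
rewrite -(@ltr_pM2l _ (2 ^+ k)) ?exprn_gt0//; apply: lt_trans ke _.
by rewrite -ltr_pdivrMr// div1r.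
Qed.

(** * Equidistribution of the images of a regular sample *)

Lemma circular_gap (p q i j : nat) (k : int) :
  (2 * q <= p)%N -> (i <= j)%N -> (j < p)%N ->
  `|j%:Z - i%:Z - k * p%:Z| < q%:Z -> (j - i < q)%N || (p < j - i + q)%N.
Proof.
move=> q2p ij jp kP.
have k_ge0 : 0 <= k by nia.
have k_lt2 : k < 2 by nia.
have [k0|k1] : k = 0 \/ k = 1 by lia.
  by subst k; lia.
by subst k; lia.
Qed.

(** The indices counted are pairwise at circular distance less than q, because
images at distance less than d come from points i/p and j/p at distance at most
d < q/p. *)
Lemma arc_count_window_le (R : realType) (d : R) (g : R -> R) (p q : nat) (t : R) :
  0 < d < 1 -> far_preserving d g -> 0 < q%:R - p%:R * d -> (2 * q <= p)%N ->
  arc_count g p d t <= q%:R.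
Proof.
move=> /andP[d0 d1] gP qpd q2p.
have d01 : 0 <= d <= 1 by rewrite !ltW.
have q0 : (0 < q)%N.
  rewrite -(ltr_nat R); apply: le_lt_trans (_ : p%:R * d < _); last by lra.
  by rewrite mulr_ge0// ltW.
have p0 : 0 < p%:R :> R by rewrite ltr0n; lia.
pose S := [set i : 'I_p | arc_ind d (g (i%:R / p%:R) - t) == 1].
have -> : arc_count g p d t = #|S|%:R.
  rewrite -sum1_card natr_sum big_mkcond /arc_count; apply: eq_bigr => i _.
  rewrite inE; have [->|[-> _]] := arc_indP (g (i%:R / p%:R) - t) d01.
    by rewrite eq_sym oner_eq0.
  by rewrite eqxx.
rewrite ler_nat; apply: circular_independent_card => // i j iS jS ij.
have SP k : k \in S -> exists n : int, 0 <= g (k%:R / p%:R) - t - n%:~R < d.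
  rewrite inE => /eqP kS.
  have [k0|[_ //]] := arc_indP (g (k%:R / p%:R) - t) d01.
  by move: kS; rewrite k0 => /eqP; rewrite eq_sym oner_eq0.
have [n /andP[n0 n1]] := SP _ iS; have [m /andP[m0 m1]] := SP _ jS.
have [|k] := gP (j%:R / p%:R) (i%:R / p%:R) (m - n).
  by rewrite ltr_norml intrB; apply/andP; split; lra.
have -> : j%:R / p%:R - i%:R / p%:R - k%:~R = (j%:R - i%:R - k%:~R * p%:R) / p%:R :> R.
  by field; rewrite gt_eqF.
rewrite normrM normfV (gtr0_norm p0) ler_pdivrMr// => kP.
have : `|j%:Z - i%:Z - k * p%:Z| < q%:Z.
  rewrite -(ltr_int R) intr_norm !intrB intrM /=; apply: le_lt_trans kP _; lra.
exact: circular_gap (ltn_ord j).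
Qed.

Lemma arc_count_multiple_le (R : realType) (d : R) (g : R -> R) (p q k : nat) (t : R) :
  (forall s, arc_count g p d s <= q%:R) -> arc_count g p (k%:R * d) t <= k%:R * q%:R.
Proof.
move=> gd; elim: k t => [|k IH] t.
  rewrite !mul0r /arc_count big1// => i _; by rewrite /arc_ind subr0 subrr.
by rewrite -natr1 !mulrDl !mul1r arc_countD lerD.
Qed.

(** Choose P and c with P d + c in [L, L + eta / 2[; then an arc of length L
contains at most as many points as P arcs of length d, laid end to end, and c
(possibly negative) full turns. *)
Lemma arc_count_le (R : realType) (d L eta : R) (g : R -> R) :
  irrational d -> 0 < d < 2^-1 -> far_preserving d g -> L <= 1 -> 0 < eta ->
  exists2 delta : R, 0 < delta & forall p q : nat, (0 < p)%N ->
    0 < q%:R - p%:R * d < delta -> forall t, arc_count g p L t <= p%:R * (L + eta).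
Proof.
move=> irr /andP[d0 d2] gP L1 eta0.
have [||P0 [Q0 [_ /andP[e0 e_lt]]]] := @below_approx R d (eta / 2) irr.
- by apply/andP; split; lra.
- by lra.
set e := _ - _ in e0 e_lt.
(* P d + c = 1 - k e lies in [L, L + e[ by the choice of k. *)
have [k /andP[ke ek]] := @nat_quotient R e (1 - L) e0 ltac:(lra).
pose P := (k * P0)%N; pose c := 1 - k%:Z * Q0%:Z.
have PcE : P%:R * d + c%:~R = 1 - k%:R * e.
  by rewrite /P /c /e natrM intrB intrM /=; ring.
have P1 : 0 < P%:R + 1 :> R by rewrite ltr_wpDl.
(* The first bound forces 2 q <= p, the second makes P (q - p d) <= eta / 2. *)
exists (Num.min ((1 - 2 * d) / 2) (eta / 2 / (P%:R + 1))).
  by rewrite lt_min !divr_gt0//; lra.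
move=> p q p0 /andP[f0]; rewrite lt_min => /andP[f1].
rewrite ltr_pdivlMr// => f2 t.
have p1 : 1 <= p%:R :> R by rewrite ler1n.
have q2p : (2 * q <= p)%N.
  rewrite -(ler_nat R) natrM.
  have : (1 - 2 * d) <= p%:R * (1 - 2 * d) by rewrite ler_peMl//; lra.
  lra.
have arcP s : arc_count g p d s <= q%:R.
  by apply: arc_count_window_le => //; apply/andP; split; lra.
apply: le_trans (@arc_count_mono _ _ _ L (P%:R * d + c%:~R) _ _) _.
  by rewrite PcE; lra.
rewrite arc_countD arc_count_int.
apply: le_trans (lerD (arc_count_multiple_le _ _ arcP) (lexx _)) _.
set f := q%:R - _ in f0 f1 f2.
have -> : P%:R * q%:R + c%:~R * p%:R = P%:R * f + p%:R * (1 - k%:R * e).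
  by rewrite -PcE /f; ring.
have : p%:R * (1 - k%:R * e) <= p%:R * (L + eta / 2).
  by rewrite ler_pM2l; lra.
have : P%:R * f <= eta / 2 by lra.
have : eta / 2 <= p%:R * (eta / 2) by rewrite ler_peMl//; lra.
lra.
Qed.

Lemma arc_count_ge (R : realType) (d L eta : R) (g : R -> R) :
  irrational d -> 0 < d < 2^-1 -> far_preserving d g -> 0 <= L -> 0 < eta ->
  exists2 delta : R, 0 < delta & forall p q : nat, (0 < p)%N ->
    0 < q%:R - p%:R * d < delta -> forall t, p%:R * (L - eta) <= arc_count g p L t.
Proof.
move=> irr d01 gP L0 eta0.
have [|delta delta0 deltaP] := @arc_count_le R d (1 - L) eta g irr d01 gP _ eta0.
  by lra.
exists delta => // p q p0 pq t.
have := deltaP p q p0 pq (t + L).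
have := arc_countD g p L (1 - L) t.
have -> : L + (1 - L) = 1%:~R by rewrite addrC subrK.
rewrite arc_count_int; lra.
Qed.

(** * The Lipschitz property *)

Lemma int_dichotomy (R : realType) (n k : int) :
  k%:~R <= n%:~R :> R \/ n%:~R + 1 <= k%:~R :> R.
Proof.
have [kn|nk] := lerP k n; first by left; rewrite ler_int.
by right; rewrite -(intrD _ n 1) ler_int; lia.
Qed.

(** Lets the counting bounds be applied to the sample points themselves. *)
Lemma far_preserving_id (R : realType) (d : R) : far_preserving d id.
Proof. by move=> x y n xy; exists n; apply: ltW. Qed.

Lemma arc_ind_near (R : realType) (d eps eta m w u : R) :
  0 < d -> 0 <= eps -> 0 < eta -> 2 * d + eps + eta <= 1 ->
  m <= w <= m + eps -> near_int d (u - w) ->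
  arc_ind (2 * d + eps + eta) (u - (m - d)) = 1.
Proof.
move=> d0 eps0 eta0 le1 /andP[w0 w1] [k]; rewrite ler_norml => /andP[k0 k1].
by apply: (@arc_ind1P _ _ _ k); apply/andP; split; lra.
Qed.

(** The two arcs on the left are disjoint: the first is the ball of radius d around
g x, the second the part of length kap of the ball around g y that ends at
g x - d + e.  Both are cut by eta on the left, so that they lie in the open
balls.  An image in either arc comes from a point within d of x or of y, hence
from the arc on the right. *)
Lemma arc_ind_two_balls (R : realType) (d eps eta m x y u rho e kap : R)
    (n : int) (g : R -> R) :
  far_preserving d g -> 0 < eta -> eta < kap -> eta < 2 * d ->
  2 * d + eps + eta <= 1 -> m <= x <= m + eps -> m <= y <= m + eps ->
  g y = g x + rho + n%:~R ->
  2 * d <= e - kap -> rho <= e - kap -> e <= rho + 2 * d -> e <= 1 ->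
  arc_ind (2 * d - eta) (g u - (g x - d + eta)) +
  arc_ind (kap - eta) (g u - (g x - d + (e - kap) + eta)) <=
  arc_ind (2 * d + eps + eta) (u - (m - d)).
Proof.
move=> gP eta0 eta_kap eta_d le1 mx my gxy e_d e_rho e_le e1.
have d0 : 0 < d by lra.
have eps0 : 0 <= eps by case/andP: mx => ? ?; lra.
have hit w : m <= w <= m + eps -> near_int d (u - w) ->
    arc_ind (2 * d + eps + eta) (u - (m - d)) = 1 by apply: arc_ind_near.
have hitx k : 0 <= g u - (g x - d + eta) - k%:~R < 2 * d - eta ->
    arc_ind (2 * d + eps + eta) (u - (m - d)) = 1.
  move=> /andP[k0 k1]; apply: (hit x mx); apply: (gP u x k).
  clear -k0 k1 eta0 d0; by rewrite ltr_norml; apply/andP; split; lra.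
have hity k : 0 <= g u - (g x - d + (e - kap) + eta) - k%:~R < kap - eta ->
    arc_ind (2 * d + eps + eta) (u - (m - d)) = 1.
  move=> /andP[k0 k1]; apply: (hit y my); apply: (gP u y (k - n)).
  clear -k0 k1 gxy eta0 e_rho e_le d0.
  by rewrite ltr_norml intrB; apply/andP; split; lra.
have indl : 0 <= 2 * d - eta <= 1 by apply/andP; split; lra.
have indr : 0 <= kap - eta <= 1 by apply/andP; split; lra.
have [->|[-> [k kP]]] := arc_indP (g u - (g x - d + eta)) indl;
have [->|[-> [l lP]]] := arc_indP (g u - (g x - d + (e - kap) + eta)) indr.
- by rewrite addr0 arc_ind_ge0//; lra.
- by rewrite add0r (hity l).
- by rewrite addr0 (hitx k).
- exfalso; move: kP lP => /andP[k0 k1] /andP[l0 l1].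
  clear -k0 k1 l0 l1 eta0 e_d e1 d0.
  by have [kl|kl] := int_dichotomy R k l; have [lk|lk] := int_dichotomy R l k; lra.
Qed.

(** If the images are at distance more than eps = |x - y|, an arc of length
kap > eps fits in the ball around g y outside the ball around g x.  The images of
the sample in these two arcs number about p (2 d + kap), while their preimages lie
in an arc with about p (2 d + eps) sample points. *)
Lemma far_preserving_local_lipschitz (R : realType) (d : R) (g : R -> R) (x y : R) :
  irrational d -> 0 < d < 2^-1 -> far_preserving d g ->
  `|x - y| < Num.min (2 * d) (1 - 2 * d) -> near_int `|x - y| (g x - g y).
Proof.
move=> irr d02 gP; have /andP[d0 d2] := d02.
set eps := `|x - y|; rewrite lt_min => /andP[eps2 eps1].
have eps0 : 0 <= eps by apply: normr_ge0.
have xy_le : x - y <= eps by apply: ler_norm.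
have yx_le : y - x <= eps by rewrite /eps distrC; apply: ler_norm.
have [n /andP[n0 n1]] := floorP (g y - g x).
have [rho gyE] : exists rho, g y = g x + rho + n%:~R.
  by exists (g y - g x - n%:~R); ring.
have rho0 : 0 <= rho by lra.
have [rho_le|rho_gt] := lerP rho eps.
  exists (- n); rewrite rmorphN/= ler_norml; apply/andP; split; lra.
have [rho_le'|rho_gt'] := lerP (1 - rho) eps.
  exists (- n - 1); rewrite intrB rmorphN/= ler_norml.
  by apply/andP; split; lra.
exfalso.
pose kap := Num.min (Num.min rho (1 - rho)) (Num.min (2 * d) (1 - 2 * d)).
have kap_gt : eps < kap by rewrite !lt_min rho_gt rho_gt' eps2 eps1.
have : kap <= kap by [].
rewrite {2}/kap !le_min => /andP[/andP[kap1 kap2] /andP[kap3 kap4]].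
have [e [e_d e_rho e_le e1]] : exists e,
    [/\ 2 * d <= e - kap, rho <= e - kap, e <= rho + 2 * d & e <= 1].
  (* The end of the ball around g y, measured from g x - d, cut at one full turn
     where the ball around g x begins again. *)
  exists (Num.min (rho + 2 * d) 1); clear -kap1 kap2 kap3 kap4.
  by case: (leP (rho + 2 * d) 1) => ?; split; lra.
clearbody kap; clear kap1 kap2 n0 n1 rho0 rho_gt rho_gt'.
(* The errors of the three counts and the cuts of the arcs amount to 6 eta. *)
have [eta etaE] : exists eta, 8 * eta = kap - eps.
  by exists ((kap - eps) / 8); rewrite mulrC divfK// pnatr_eq0.
have eta0 : 0 < eta by lra.
have le1 : 2 * d + eps + eta <= 1 by lra.
have mxy : Num.min x y <= x <= Num.min x y + eps /\ Num.min x y <= y <= Num.min x y + eps.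
  clear -xy_le yx_le eps0.
  by case: (leP x y) => xy; split; apply/andP; split; lra.
have [|del1 del1_0 del1P] := @arc_count_ge R d (2 * d - eta) eta g irr d02 gP _ eta0.
  by lra.
have [|del2 del2_0 del2P] := @arc_count_ge R d (kap - eta) eta g irr d02 gP _ eta0.
  by lra.
have [del3 del3_0 del3P] := @arc_count_le R d (2 * d + eps + eta) eta id irr d02
    (@far_preserving_id R d) le1 eta0.
have [||p [q [p0 /andP[f0 f1]]]] :=
    @below_approx R d (Num.min del1 (Num.min del2 del3)) irr.
- by clear -d0 d2; apply/andP; split; lra.
- by rewrite !lt_min del1_0 del2_0.
move: f1; rewrite !lt_min => /and3P[f1 f2 f3].
have := del1P p q p0 _ (g x - d + eta); rewrite f0 f1 => /(_ isT).
have := del2P p q p0 _ (g x - d + (e - kap) + eta); rewrite f0 f2 => /(_ isT).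
have := del3P p q p0 _ (Num.min x y - d); rewrite f0 f3 => /(_ isT).
have : arc_count g p (2 * d - eta) (g x - d + eta) +
       arc_count g p (kap - eta) (g x - d + (e - kap) + eta) <=
       arc_count id p (2 * d + eps + eta) (Num.min x y - d).
  rewrite /arc_count -big_split /=; apply: ler_sum => i _.
  by case: mxy => mx my; apply: (arc_ind_two_balls _ gP _ _ _ _ mx my gyE) => //; lra.
clear -p0 etaE eta0 => h h3 h2 h1.
have : p%:R * (2 * d - eta - eta + (kap - eta - eta)) <= p%:R * (2 * d + eps + eta + eta).
  by lra.
by rewrite ler_pM2l ?ltr0n//; lra.
Qed.

Lemma small_subdivision (R : realType) (del t : R) : 0 < del ->
  exists (N : nat) (h : R), t = N%:R * h /\ `|h| < del.
Proof.
move=> del0; pose N := (Num.bound (`|t| / del)).+1; exists N, (t / N%:R).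
have N0 : 0 < N%:R :> R by rewrite ltr0n.
split; first by rewrite mulrC divfK// gt_eqF.
rewrite normrM normfV (gtr0_norm N0) ltr_pdivrMr// mulrC -ltr_pdivrMr//.
apply: lt_trans (archi_boundP _) _; first by rewrite divr_ge0// ltW.
by rewrite ltr_nat /N ltnSn.
Qed.

Lemma far_preserving_lipschitz (R : realType) (d : R) (g : R -> R) (x y : R) :
  irrational d -> 0 < d < 2^-1 -> far_preserving d g ->
  near_int `|x - y| (g x - g y).
Proof.
move=> irr d02 gP; have /andP[d0 d2] := d02.
pose del := Num.min (2 * d) (1 - 2 * d).
have del0 : 0 < del by rewrite lt_min; apply/andP; split; lra.
have [N [h [xyE h_lt]]] := small_subdivision (x - y) del0.
have chain k : near_int (k%:R * `|h|) (g (y + k%:R * h) - g y).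
  elim: k => [|k IH].
    by exists 0; rewrite !mul0r addr0 subrr subr0 normr0.
  have := @far_preserving_local_lipschitz _ d g (y + k.+1%:R * h) (y + k%:R * h)
    irr d02 gP.
  have -> : y + k.+1%:R * h - (y + k%:R * h) = h by rewrite -natr1; ring.
  move=> /(_ h_lt) step; have := near_intD step IH.
  have -> : k.+1%:R * `|h| = `|h| + k%:R * `|h| by rewrite -natr1; ring.
  by rewrite addrA subrK.
have := chain N.
by rewrite -xyE [y + _]addrC subrK xyE normrM normr_nat.
Qed.

Lemma step_invariant_everywhere (R : realType) (del : R) (Q : R -> Prop) :
  0 < del -> (forall x y, `|x - y| < del -> Q x -> Q y) ->
  forall x y, Q x -> Q y.
Proof.
move=> del0 Qstep x y Qx.
have [N [h [yxE h_lt]]] := small_subdivision (y - x) del0.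
have chain k : Q (x + k%:R * h).
  elim: k => [|k IH]; first by rewrite mul0r addr0.
  apply: Qstep IH.
  have -> : x + k%:R * h - (x + k.+1%:R * h) = - h by rewrite -natr1; ring.
  by rewrite normrN.
by have := chain N; rewrite -yxE [x + _]addrC subrK.
Qed.

(** * Rigidity *)

Lemma near_int_all (R : realType) (t : R) :
  (forall eta, 0 < eta -> near_int eta t) -> exists n : int, t = n%:~R.
Proof.
move=> tP; have [n /andP[n0 n1]] := floorP t; exists n.
apply/eqP; rewrite eq_le n0 andbT leNgt; apply/negP => n_lt.
pose a := Num.min (t - n%:~R) (n%:~R + 1 - t).
have a0 : 0 < a by rewrite lt_min; apply/andP; split; lra.
have : a <= a by [].
rewrite {2}/a le_min => /andP[a1 a2].
have [|k] := tP (a / 2); first by lra.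
rewrite ler_norml => /andP[k0 k1].
by have [nk|nk] := int_dichotomy R n k; lra.
Qed.

(** The Lipschitz property bounds the distance of the images by d.  If it were
smaller, moving x + d slightly away from x would give points at distance more
than d whose images are still closer than d. *)
Lemma far_preserving_step (R : realType) (d : R) (g : R -> R) (x : R) :
  irrational d -> 0 < d < 2^-1 -> far_preserving d g ->
  (exists n : int, g (x + d) - g x = d + n%:~R) \/
  (exists n : int, g (x + d) - g x = - d + n%:~R).
Proof.
move=> irr d02 gP; have /andP[d0 d2] := d02.
have [n] := @far_preserving_lipschitz _ d g (x + d) x irr d02 gP.
have -> : x + d - x = d by ring.
rewrite (gtr0_norm d0) le_eqVlt => /orP[/eqP|] nP.
  have [c0|c0] := lerP 0 (g (x + d) - g x - n%:~R).
    by left; exists n; move: nP; rewrite ger0_norm//; lra.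
  by right; exists n; move: nP; rewrite ltr0_norm//; lra.
exfalso; set a := `|_| in nP.
pose eta := Num.min (d - a) (1 - 2 * d) / 2.
have eta0 : 0 < eta by rewrite divr_gt0// lt_min; apply/andP; split; lra.
have : Num.min (d - a) (1 - 2 * d) <= 2 * eta by rewrite /eta; lra.
have : 2 * eta <= Num.min (d - a) (1 - 2 * d) by rewrite /eta; lra.
rewrite le_min => /andP[eta1 eta2] _.
have [m] := @far_preserving_lipschitz _ d g (x + d + eta) (x + d) irr d02 gP.
have -> : x + d + eta - (x + d) = eta by ring.
rewrite (gtr0_norm eta0) => mP.
have [|k] := gP (x + d + eta) x (m + n).
  have -> : g (x + d + eta) - g x - (m + n)%:~R =
    (g (x + d + eta) - g (x + d) - m%:~R) + (g (x + d) - g x - n%:~R).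
    by rewrite intrD; ring.
  apply: le_lt_trans (ler_normD _ _) _.
  by rewrite -/a; lra.
rewrite ler_norml => /andP[k0 k1].
by have [kk|kk] := int_dichotomy R 0 k; move: kk => /=; lra.
Qed.

(** A change of sign between nearby points x and y would make 2 d close to an
integer, whereas 0 < 2 d < 1. *)
Lemma far_preserving_step_const (R : realType) (d : R) (g : R -> R) (x y : R) :
  irrational d -> 0 < d < 2^-1 -> far_preserving d g ->
  (exists n : int, g (x + d) - g x = d + n%:~R) ->
  exists n : int, g (y + d) - g y = d + n%:~R.
Proof.
move=> irr d02 gP; have /andP[d0 d2] := d02.
pose del := Num.min (2 * d) (1 - 2 * d) / 2.
have del0 : 0 < del by rewrite divr_gt0// lt_min; apply/andP; split; lra.
have : 2 * del <= Num.min (2 * d) (1 - 2 * d) by rewrite /del; lra.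
rewrite le_min => /andP[del1 del2]; clearbody del.
move: x y; apply: (@step_invariant_everywhere _ _ _ del0) => x y xy [n nE].
have [//|[m mE]] := @far_preserving_step R d g y irr d02 gP; exfalso.
have [k] := @far_preserving_lipschitz R d g (x + d) (y + d) irr d02 gP.
have -> : x + d - (y + d) = x - y by ring.
rewrite ler_norml => /andP[k0 k1].
have [l] := @far_preserving_lipschitz R d g x y irr d02 gP.
rewrite ler_norml => /andP[l0 l1].
have := int_dichotomy R 0 (k - l - n + m); rewrite intrD !intrB /=.
by case=> ?; lra.
Qed.

(** With e = q - p d small, the multiples k p d are congruent to - k e modulo 1,
and these step backwards through the circle from the next integer down to y. *)
Lemma dense_multiples (R : realType) (d y eta : R) :
  irrational d -> 0 < d < 1 -> 0 < eta ->
  exists (k : nat) (m : int), `|y - k%:R * d - m%:~R| <= eta.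
Proof.
move=> irr d01 eta0.
have [p [q [_ /andP[e0 e1]]]] := @below_approx R d eta irr d01 eta0.
have [j /andP[_ jy]] := floorP y.
have [k /andP[k0 k1]] := @nat_quotient R _ (j%:~R + 1 - y) e0 ltac:(lra).
exists (k * p)%N, (j + 1 - k%:Z * q%:Z).
rewrite natrM intrB intrD intrM /= ler_norml.
by apply/andP; split; lra.
Qed.

(** Both sides are 1-Lipschitz in y and agree modulo 1 on the dense set of points
x + k d + m. *)
Lemma far_preserving_translation (R : realType) (d : R) (g : R -> R) (x y : R) :
  irrational d -> 0 < d < 2^-1 -> far_preserving d g ->
  (forall (z : R) (m : int), g (z + m%:~R) = g z) ->
  (exists n : int, g (x + d) - g x = d + n%:~R) ->
  exists n : int, g y - g x - (y - x) = n%:~R.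
Proof.
move=> irr d02 gP gper stepx; have /andP[d0 d2] := d02.
have step z := @far_preserving_step_const R d g x z irr d02 gP stepx.
have steps k : exists n : int, g (x + k%:R * d) - g x = k%:R * d + n%:~R.
  elim: k => [|k [n nE]]; first by exists 0; rewrite !mul0r !addr0 subrr.
  have [m mE] := step (x + k%:R * d); exists (n + m).
  have -> : x + k.+1%:R * d = x + k%:R * d + d by rewrite -natr1; ring.
  by rewrite -natr1 intrD; lra.
apply: near_int_all => eta eta0.
have [||k [m mP]] := @dense_multiples R d (y - x) (eta / 2) irr.
- by apply/andP; split; lra.
- by lra.
have [n nE] := steps k.
have [l lP] := @far_preserving_lipschitz R d g y (x + k%:R * d + m%:~R) irr d02 gP.
rewrite gper in lP.
exists (l + n - m).
have -> : g y - g x - (y - x) - (l + n - m)%:~R =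
    (g y - g (x + k%:R * d) - l%:~R) - (y - x - k%:R * d - m%:~R).
  by rewrite intrB intrD; lra.
apply: le_trans (ler_normB _ _) _.
have E : y - (x + k%:R * d + m%:~R) = y - x - k%:R * d - m%:~R by ring.
by move: lP; rewrite E; lra.
Qed.

Lemma far_preservingN (R : realType) (d : R) (g : R -> R) :
  far_preserving d g -> far_preserving d (fun x => - g x).
Proof.
move=> gP x y n; have -> : - g x - - g y - n%:~R = - (g x - g y - (- n)%:~R).
  by rewrite rmorphN /=; ring.
by rewrite normrN; apply: gP.
Qed.

Lemma far_preserving_rigid (R : realType) (d : R) (g : R -> R) :
  irrational d -> 0 < d < 2^-1 -> far_preserving d g ->
  (forall (z : R) (m : int), g (z + m%:~R) = g z) ->
  (forall y, exists n : int, g y = g 0 + y + n%:~R) \/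
  (forall y, exists n : int, g y = g 0 - y + n%:~R).
Proof.
move=> irr d02 gP gper.
have [pos|[m mE]] := @far_preserving_step R d g 0 irr d02 gP; [left|right] => y.
  have [n nE] := far_preserving_translation y irr d02 gP gper pos.
  by exists n; lra.
have neg : exists n : int, - g (0 + d) - - g 0 = d + n%:~R.
  by exists (- m); rewrite rmorphN /=; lra.
have [n nE] := far_preserving_translation y irr d02 (far_preservingN gP)
  (fun z l => congr1 -%R (gper z l)) neg.
by exists (- n); rewrite rmorphN /=; lra.
Qed.

(** * From the circle to the real line *)

Local Open Scope quotient_scope.

Lemma circle_piP (R : realType) (x y : R) :
  \pi_(circle R) x = \pi_(circle R) y <-> exists n : int, x - y = n%:~R.
Proof.
have idealE := Quotient.idealrBE
  (GRing.ZmodClosed.clone R (@Num.int_num_subdef R) _) x y.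
split=> [/eqP|[n xyE]].
  by rewrite -idealE => /intrP.
by apply/eqP; rewrite -idealE xyE; apply/intrP; exists n.
Qed.

Lemma circle_dist_le (R : realType) (x y : R) (n : int) :
  circle_dist (\pi_(circle R) x) (\pi_(circle R) y) <= `|x - y - n%:~R|.
Proof.
have frac_le (t : R) (k : int) : 0 <= t - k%:~R ->
    t - (Num.floor t)%:~R <= t - k%:~R.
  by move=> kt; rewrite lerB// ler_int floor_ge_int; lra.
rewrite /circle_dist ge_min !arcE; have [c0|c0] := lerP 0 (x - y - n%:~R).
  by apply/orP; right; rewrite ger0_norm// frac_le.
apply/orP; left; rewrite ltr0_norm//.
have := @frac_le (y - x) (- n); rewrite rmorphN /= => h.
by apply: le_trans (h _) _; lra.
Qed.

Lemma near_int_circle_dist (R : realType) (e x y : R) :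
  circle_dist (\pi_(circle R) x) (\pi_(circle R) y) <= e -> near_int e (x - y).
Proof.
rewrite /circle_dist ge_min !arcE => /orP[] h.
  rewrite -opprB; apply: near_intN; exists (Num.floor (y - x)).
  by rewrite ger0_norm// subr_ge0 floor_le.
by exists (Num.floor (x - y)); rewrite ger0_norm// subr_ge0 floor_le.
Qed.

Lemma cohomomorphism_far_preserving (R : realType) (r : R)
    (f : circle R -> circle R) (g : R -> R) :
  0 < r -> (forall x, \pi_(circle R) (g x) = f (\pi_(circle R) x)) ->
  @cohomomorphism (E_open r) (E_open r) f \/
  @cohomomorphism (E_closed r) (E_closed r) f ->
  far_preserving r^-1 g.
Proof.
move=> r0 gE hf x y n xy; apply: near_int_circle_dist.
have ri0 : 0 < r^-1 by rewrite invr_gt0.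
set u := \pi_(circle R) x; set v := \pi_(circle R) y.
rewrite leNgt; apply/negP => uv_far.
have fuv : circle_dist (f u) (f v) < r^-1.
  by rewrite -!gE; apply: le_lt_trans xy; apply: circle_dist_le.
have uv : u <> v.
  move=> uvE; move: uv_far; rewrite uvE => vv.
  have := @circle_dist_le R y y 0; rewrite !subr0 subrr normr0 => vv0.
  by have := lt_trans ri0 (lt_le_trans vv vv0); rewrite ltxx.
case: hf => hf; have [] := hf u v uv; rewrite /adj /=.
- by case=> _ /lt_trans/(_ uv_far); rewrite ltxx.
- by move=> fne; apply; split.
- by case=> _; rewrite leNgt uv_far.
- by move=> fne; apply; split=> //; apply: ltW.
Qed.

Theorem theorem5p6 (R : realType) (r : R) (hr : 2 <= r) (hirr : irrational r)
    (f : circle R -> circle R)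
    (hf : @cohomomorphism (E_open r) (E_open r) f \/
          @cohomomorphism (E_closed r) (E_closed r) f) :
  exists a : circle R,
    f =1 rotation a \/ exists c : circle R, f =1 rotation a \o reflection c.
Proof.
have r0 : 0 < r by lra.
have irr : irrational r^-1.
  by move=> [s _ sE]; apply: hirr; exists s^-1; rewrite ?fmorphV /= ?sE ?invrK.
have d02 : 0 < r^-1 < 2^-1.
  rewrite invr_gt0 r0 ltf_pV2 ?posrE// lt_neqAle hr andbT.
  (* The case r = 2 is excluded by irrationality. *)
  apply/eqP => r2; apply: hirr; exists 2; first by [].
  by rewrite -r2 ratr_nat.
pose g x := repr (f (\pi_(circle R) x)).
have gE x : \pi_(circle R) (g x) = f (\pi_(circle R) x) by rewrite reprK.
have gper (z : R) (m : int) : g (z + m%:~R) = g z.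
  rewrite /g; congr (repr (f _)); apply/circle_piP.
  by exists m; rewrite addrAC subrr add0r.
have gP := cohomomorphism_far_preserving r0 gE hf.
exists (\pi_(circle R) (g 0)).
have [rot|refl] := far_preserving_rigid irr d02 gP gper; [left|right].
  move=> p; rewrite /rotation -[p]reprK -gE -raddfD; apply/circle_piP.
  by have [n ->] := rot (repr p); exists n; ring.
exists 0 => p; rewrite /= /rotation /reflection mul0rn sub0r.
rewrite -[p]reprK -gE -raddfN -raddfD; apply/circle_piP.
by have [n ->] := refl (repr p); exists n; ring.
Qed.
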